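(* Let $n\geq 6$ be an integer and let $T_n$ be the simple graph with vertex set $V(T_n)=\{j^{l}_{r} : 1\leq r\leq 4,\ 1\leq l\leq n\}$ ($4n$ distinct vertices) and edge set $$E(T_n)=\{\, j^{l}_{r}j^{l+1}_{r},\ j^{l}_{1}j^{l}_{2},\ j^{l}_{2}j^{l}_{3},\ j^{l}_{3}j^{l}_{4},\ j^{l}_{2}j^{l+1}_{1},\ j^{l}_{3}j^{l+1}_{2} \ :\ r\in\{1,2,4\},\ 1\leq l\leq n \,\},$$ where superscripts are taken modulo $n$ (so $j^{n+1}_r=j^1_r$). Then the fault-tolerant metric dimension of $T_n$ is $\mathrm{fdim}(T_n)=4$.
   Context: Let $\Gamma=(V,E)$ be a non-trivial, undirected, simple, connected graph, and let $d(u,v)$ denote the length of a shortest $u$–$v$ path. For a set $R=\{u^1,\dots,u^t\}\subseteq V$ (ordered), the code of a vertex $u$ with respect to $R$ is the tuple $(d(u,u^1),\dots,d(u,u^t))$. The set $R$ is a resolving set for $\Gamma$ if distinct vertices of $\Gamma$ have distinct codes with respect to $R$. A resolving set $R_f$ is fault-tolerant if $R_f\setminus\{u\}$ is also a resolving set for every $u\in R_f$. The fault-tolerant metric dimension $\mathrm{fdim}(\Gamma)$ is the minimum cardinality of a fault-tolerant resolving set of $\Gamma$. *)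

(* Defs.v *)
From mathcomp Require Import all_boot.

Set Implicit Arguments.
Unset Strict Implicit.
Unset Printing Implicit Defensive.

(* Graphs are adjacency relations on a finite vertex type. *)
Section FaultTolerantMetricDimension.

Variables (V : finType) (e : rel V).

Definition has_path_of_length (u v : V) (k : nat) : bool :=
  [exists p : k.-tuple V, [&& path e u p, uniq (u :: p) & last u p == v]].

(* The paths have distinct vertices, so their lengths are < #|V|; the value is
   #|V| when v cannot be reached from u. *)
Definition dist (u v : V) : nat :=
  find (has_path_of_length u v) (iota 0 #|V|).

(* R is ordered by [enum]; resolvability does not depend on the order. *)
Definition code (R : {set V}) (u : V) : seq nat :=
  [seq dist u w | w <- enum R].

Definition resolving (R : {set V}) : bool := injectiveb (code R).

Definition fault_tolerant (R : {set V}) : bool :=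
  resolving R && [forall u in R, resolving (R :\ u)].

(* The minimum is over a nonempty family: see [fault_tolerant_setT]. *)
Definition fdim : nat :=
  #|[arg min_(R < [set: V] | fault_tolerant R) #|R| ]|.

Lemma dist_eq0 (u v : V) : (dist u v == 0) = (u == v).
Proof.
rewrite /dist; have: 0 < #|V| by apply/card_gt0P; exists u.
case: #|V| => // m _ /=.
have -> : has_path_of_length u v 0 = (u == v).
  apply/existsP/idP => [[p]|uv]; first by rewrite (tuple0 p).
  by exists [tuple]; rewrite /= uv.
by case: (u == v).
Qed.

Lemma resolving_mem (R : {set V}) :
  (forall u v, u != v -> (u \in R) || (v \in R)) -> resolving R.
Proof.
move=> hR; apply/injectiveP => u v /eq_in_map huv.
apply/eqP/negPn/negP => neq_uv.
have /orP[uR|vR] := hR u v neq_uv.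
- have := huv u; rewrite mem_enum => /(_ uR).
  have /eqP -> : dist u u == 0 by rewrite dist_eq0.
  by move/esym/eqP; rewrite dist_eq0 eq_sym (negPf neq_uv).
- have := huv v; rewrite mem_enum => /(_ vR).
  have /eqP -> : dist v v == 0 by rewrite dist_eq0.
  by move/eqP; rewrite dist_eq0 (negPf neq_uv).
Qed.

Lemma fault_tolerant_setT : fault_tolerant [set: V].
Proof.
apply/andP; split; first by apply: resolving_mem => u v; rewrite inE.
apply/forall_inP => w _; apply: resolving_mem => u v neq_uv.
by rewrite !inE !andbT -negb_and; apply: contra neq_uv => /andP[/eqP-> /eqP->].
Qed.

Lemma fdimP (k : nat) :
  fdim = k <-> (exists2 R, fault_tolerant R & #|R| = k) /\
               (forall R, fault_tolerant R -> k <= #|R|).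
Proof.
rewrite /fdim; case: arg_minnP => [|R ftR minR]; first exact: fault_tolerant_setT.
split=> [<-|[[S ftS <-] minS]]; first by split=> //; exists R.
by apply/eqP; rewrite eqn_leq minR // minS.
Qed.

End FaultTolerantMetricDimension.

(* The vertex j^l_r, with 1 <= r <= 4 and 1 <= l <= n, is the pair of the
   zero-based indices (r - 1, l - 1); [ordS] is the successor modulo n. *)
Definition Tn_vertex (n : nat) : finType := ('I_4 * 'I_n)%type.

(* The edges of E(T_n), each in the orientation in which it is listed. *)
Definition Tn_arc (n : nat) : rel (Tn_vertex n) := fun x y =>
  let: (r, l) := x in let: (s, m) := y in
  [|| [&& r.+1 \in [:: 1; 2; 4], s == r & m == ordS l],
      ((r.+1, s.+1) \in [:: (1, 2); (2, 3); (3, 4)]) && (m == l)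
    | ((r.+1, s.+1) \in [:: (2, 1); (3, 2)]) && (m == ordS l)].

Definition Tn (n : nat) : rel (Tn_vertex n) :=
  fun x y => Tn_arc x y || Tn_arc y x.

Lemma Tn_sym (n : nat) : symmetric (@Tn n).
Proof. by move=> x y; rewrite /Tn orbC. Qed.

Lemma Tn_irreflexive (n : nat) : 1 < n -> irreflexive (@Tn n).
Proof.
move=> n_gt1 [r l]; rewrite /Tn orbb /=.
have /negPf nS : l != ordS l.
  apply/eqP => /(congr1 val) /=; case: l => l /= ltln.
  have [lt|] := ltnP l.+1 n; first by rewrite modn_small // => /n_Sn.
  move=> le; have En : l.+1 = n by apply/eqP; rewrite eqn_leq ltln.
  by rewrite En modnn => l0; rewrite -En l0 in n_gt1.
rewrite nS !andbF orbF.
by case: r => [[|[|[|[|]]]]].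
Qed.

Lemma Tn_connected (n : nat) (x y : Tn_vertex n) : connect (@Tn n) x y.
Proof.
have csym := sym_connect_sym (@Tn_sym n).
have col (r : 'I_4) (l : 'I_n) : connect (@Tn n) (ord0, l) (r, l).
  case: r; elim=> [|r IHr] ltr.
    by rewrite (_ : Ordinal ltr = ord0) //; apply: val_inj.
  apply: connect_trans (IHr (ltnW ltr)) _; apply: connect1.
  apply/orP; left; rewrite /= eqxx /= andbT.
  by case: r ltr {IHr} => [|[|[|r]]] //= _; rewrite orbT.
have row k : forall l m : 'I_n, l + k = m ->
    connect (@Tn n) (ord0, l) (ord0, m).
  elim: k => [|k IHk] l m; first by rewrite addn0 => /val_inj ->.
  rewrite addnS => lkm.
  have ltk : l + k < n by rewrite -ltnS lkm ltnS ltnW.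
  apply: connect_trans (IHk l (Ordinal ltk) erefl) _; apply: connect1.
  have -> : m = ordS (Ordinal ltk) by apply/val_inj; rewrite /= lkm modn_small.
  by apply/orP; left; rewrite /Tn_arc !eqxx.
case: x y => [r l] [s m].
rewrite (connect_trans _ (col s m)) // csym (connect_trans _ (col r l)) // {r s}.
have [lem|/ltnW lem] := leqP l m; first by rewrite csym (row (m - l)) ?subnKC.
by rewrite (row (l - m)) ?subnKC.
Qed.

(* Main.v *)
(* T_n is covered by an infinite strip, in which distances have a closed form;
   the distance in T_n is the smaller of the strip distances in the two
   directions. A function with a single zero that changes by at most one along
   edges and decreases along some edge at every other vertex is a distance, which
   reduces the closed form to linear arithmetic.

   Two landmarks u, w never resolve T_n: every vertex u has at least six vertices
   at distance 2, and their distances to w lie in an interval of five integers.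
   So a resolving set has at least three elements, and a fault-tolerant one at
   least four. Conversely, among the four distances to j^1_1, j^2_1, j^{h+1}_1 and
   j^1_4, where h = floor(n / 2), any three determine the vertex. *)

Require Import Defs.
From mathcomp Require Import all_boot zify.
Set Implicit Arguments.
Unset Strict Implicit.
Unset Printing Implicit Defensive.

(** * Distances and resolving sets in an arbitrary finite graph *)

Section Graph.

Variables (V : finType) (e : rel V).

Lemma dist_path u v : dist e u v < #|V| ->
  exists p, [/\ path e u p, last u p = v & size p = dist e u v].
Proof.
rewrite /dist; case: findP => [|i]; rewrite size_iota ?ltnn // => ltiV /(_ 0).
rewrite nth_iota // => /existsP[p /and3P[up _ /eqP pv]] _ _.
by exists p; split; rewrite ?size_tuple.
Qed.

(** The Lipschitz condition bounds the length of every path from [u] to [v] below by [f u];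
    descending along [f] gives a path of exactly that length. *)
Lemma dist_potential (f : V -> nat) v :
    (forall x, (f x == 0) = (x == v)) ->
    (forall x y, e x y -> f x <= (f y).+1) ->
    (forall x, 0 < f x -> exists2 y, e x y & f y < f x) ->
  forall u, dist e u v = f u.
Proof.
move=> f0 f_lip f_desc u.
have f_path p : path e u p -> f u <= f (last u p) + size p.
  elim: p u => [|y p IHp] u /=; first by rewrite addn0.
  by case/andP=> /f_lip uy /IHp yp; lia.
(* Since [f] decreases along this path, no vertex repeats, so its length lies in the range searched
   by [dist]. *)
have [p [up pv sp _ Up]] : exists p, [/\ path e u p, last u p = v, size p = f u,
    all (fun y => f y < f u) p & uniq (u :: p)].
  have [k fu] : exists k, f u = k by exists (f u).
  elim: k u fu {f_path} => [|k IHk] u fu.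
    by exists [::]; split=> //; apply/eqP; rewrite -f0 fu.
  have [|y uy yu] := f_desc u; first by rewrite fu.
  have fy : f y = k by have := f_lip _ _ uy; lia.
  have [|p [yp pv sp pu Up]] := IHk y; first by rewrite fy.
  have pu' : all (fun z => f z < f u) (y :: p).
    by rewrite /= yu; apply: sub_all pu => z /=; lia.
  exists (y :: p); split=> //; [by rewrite /= uy | by rewrite /= sp fy fu |].
  by rewrite cons_uniq Up andbT; apply/negP => /(allP pu'); rewrite ltnn.
have ltuV : f u < #|V|.
  by rewrite -sp -[_.+1]/(size (u :: p)) -(card_uniqP Up) max_card.
rewrite /dist; case: findP => [/hasPn|i]; rewrite ?size_iota.
  move=> /(_ (f u)); rewrite mem_iota /= => /(_ ltuV)/existsP[].
  rewrite -sp; exists (in_tuple p); apply/and3P; split=> //; exact/eqP.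
move=> ltiV /(_ 0); rewrite nth_iota // add0n.
move=> /existsP[q /and3P[uq _ /eqP qv]] lt_i.
apply/eqP; rewrite eqn_leq; apply/andP; split; last first.
  have := f_path _ uq; rewrite qv size_tuple.
  by have /eqP-> : f v == 0 by rewrite f0.
rewrite leqNgt; apply/negP => /(lt_i 0); rewrite nth_iota // add0n => /existsP[].
rewrite -sp; exists (in_tuple p); apply/and3P; split=> //; exact/eqP.
Qed.

Lemma dist_lipschitz (f : V -> nat) u v :
    (forall x y, e x y -> f x <= (f y).+1 /\ f y <= (f x).+1) ->
    dist e u v < #|V| ->
  f u <= f v + dist e u v /\ f v <= f u + dist e u v.
Proof.
move=> f_lip /dist_path[p [up <- <-]].
elim: p u up => [|y p IHp] u /=; first by rewrite addn0.
by case/andP=> /f_lip[uy yu] /IHp[yp py]; split; lia.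
Qed.

(* On the sphere of radius [k] around [u], the distance to [w] takes at most
   [2k + 1] values. *)
Lemma sphere_collision u w k (S : seq V) :
    (forall x y, e x y ->
       dist e x w <= (dist e y w).+1 /\ dist e y w <= (dist e x w).+1) ->
    k < #|V| -> uniq S -> {in S, forall x, dist e x u = k} ->
    k.*2.+1 < size S ->
  exists x y, [/\ x != y, dist e x u = dist e y u & dist e x w = dist e y w].
Proof.
move=> lip ltkV uS Sk ltS; set g := fun x => dist e x w.
have /(uniqPn 0)[i [j [ltij]]] : ~~ uniq (map g S).
  apply/negP => Ug; suff : size (map g S) <= k.*2.+1 by rewrite size_map leqNgt ltS.
  (* If [g u < k], the difference is 0 and the interval still contains [g u + k]. *)
  rewrite -(size_iota (g u - k) k.*2.+1); apply: uniq_leq_size => // _ /mapP[x xS ->].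
  have := @dist_lipschitz g x u lip; rewrite Sk // => /(_ ltkV)[].
  by rewrite mem_iota; lia.
rewrite size_map => ltjS; have ltiS := ltn_trans ltij ltjS.
rewrite !(nth_map u) // => gij.
exists (nth u S i), (nth u S j); split=> //; last by rewrite !Sk ?mem_nth.
by rewrite nth_uniq // neq_ltn ltij.
Qed.

Lemma resolvingP (R : {set V}) :
  reflect (forall x y, {in R, forall w, dist e x w = dist e y w} -> x = y)
          (resolving e R).
Proof.
rewrite /resolving; apply: (iffP (injectiveP _)) => injR x y xyR; apply: injR.
  by apply/eq_in_map => w; rewrite mem_enum => /xyR.
by move=> w wR; move/eq_in_map: xyR; apply; rewrite mem_enum.
Qed.

Lemma resolving_card (R : {set V}) (x0 : V) :
    (forall u w, exists x y,
       [/\ x != y, dist e x u = dist e y u & dist e x w = dist e y w]) ->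
  resolving e R -> 2 < #|R|.
Proof.
move=> coll /resolvingP injR; rewrite ltnNge; apply/negP => leR2.
(* If [R] has fewer than two elements, [x0] stands in for the missing landmarks. *)
have [x [y [/eqP neq_xy xyu xyw]]] := coll (nth x0 (enum R) 0) (nth x0 (enum R) 1).
case: neq_xy; apply: injR => v; rewrite -mem_enum => /(nthP x0)[i lti <-].
by move: lti; rewrite -cardE => /leq_trans/(_ leR2); case: i => [|[|]].
Qed.

Lemma fault_tolerant_card (R : {set V}) (k : nat) :
    (forall S, resolving e S -> k < #|S|) ->
  fault_tolerant e R -> k.+1 < #|R|.
Proof.
move=> lek /andP[/lek ltkR /forall_inP ftR].
have /card_gt0P[u uR] : 0 < #|R| by apply: leq_ltn_trans ltkR.
by rewrite (cardsD1 u) uR ltnS lek ?ftR.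
Qed.

End Graph.

(** * The closed form of the distance in [Tn] *)

(* In the infinite strip that covers T_n, the distance from a vertex of row [s]
   to the vertex of row [r] lying [k] columns to its right. The Boolean
   corrections come from the missing edges of row 2 (indices from 0), which force
   a detour through row 1, and from the vertical edge between rows 2 and 3. *)
Definition strip_dist (s r k : nat) : nat :=
  if s <= r then k + (r - s) + [&& s == 2, r == 2 & 0 < k]
  else maxn (k + (s == 3)) (s - r).

(* A shortest path goes around the cycle in one of the two directions; going
   left from row [s] is going right from row [r] by [n - k] columns. *)
Definition cyl_dist (n s r k : nat) : nat :=
  minn (strip_dist s r k) (strip_dist r s (n - k)).

(** For columns below [n] this is [l - m] modulo [n], split into cases to stay linear. *)
Definition offset (n m l : nat) : nat := if m <= l then l - m else l + n - m.

Lemma offset_lt n m l : m < n -> l < n -> offset n m l < n.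
Proof. by rewrite /offset; case: (leqP m l); lia. Qed.

Lemma offset_eq0 n m l : m < n -> l < n -> (offset n m l == 0) = (l == m).
Proof. by rewrite /offset; case: (leqP m l); lia. Qed.

Lemma offset_ordS n m (l : 'I_n) : m < n ->
  offset n m (ordS l) = if (offset n m l).+1 == n then 0 else (offset n m l).+1.
Proof.
move=> ltmn; have ltln := ltn_ord l; rewrite /offset /=.
have [lt|le] := ltnP l.+1 n; last first.
  rewrite (_ : l.+1 = n) ?modnn; last by lia.
  by case: (leqP m l); case: (leqP m 0); case: eqVneq; lia.
by rewrite modn_small //; case: (leqP m l); case: (leqP m l.+1); case: eqVneq; lia.
Qed.

Lemma offset_ord_pred n m (l : 'I_n) : m < n ->
  offset n m (ord_pred l) =
  if offset n m l == 0 then n.-1 else (offset n m l).-1.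
Proof.
move=> ltmn; rewrite -[in RHS](ord_predK l) offset_ordS //.
have := offset_lt ltmn (ltn_ord (ord_pred l)).
by move: (offset _ _ _) => k _; case: (eqVneq k.+1 n) => [<-|_] /=.
Qed.

Lemma cyl_dist_eq0 n s r k : 5 < n -> s < 4 -> r < 4 -> k < n ->
  (cyl_dist n s r k == 0) = (r == s) && (k == 0).
Proof.
move=> n6; rewrite /cyl_dist /strip_dist.
by move: s r => [|[|[|[|//]]]] [|[|[|[|//]]]] _ _ ltkn /=; lia.
Qed.

Definition Tn_dist n (v x : Tn_vertex n) : nat :=
  cyl_dist n v.1 x.1 (offset n v.2 x.2).

Lemma Tn_dist_arc n (v x y : Tn_vertex n) : 5 < n -> Tn_arc x y ->
  Tn_dist v x <= (Tn_dist v y).+1 /\ Tn_dist v y <= (Tn_dist v x).+1.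
Proof.
case: v x y => [[s s4] m] [[r r4] l] [[t t4] i] n6.
have := offset_lt (ltn_ord m) (ltn_ord l).
have := offset_ordS l (ltn_ord m).
rewrite /Tn_dist /Tn_arc -val_eqE /= => kS ltkn.
case/or3P=> [/and3P[rt /eqP /= def_t /eqP->]|/andP[rt /eqP->]|/andP[rt /eqP->]].
all: move: rt ltkn; rewrite ?kS /= ?{}def_t /cyl_dist /strip_dist => {kS}.
all: move: (offset n m l) => k + ltkn.
2,3: move: s r t s4 r4 t4 => [|[|[|[|//]]]] [|[|[|[|//]]]] [|[|[|[|//]]]] _ _ _ //= _.
1: move: s r s4 r4 t4 => [|[|[|[|//]]]] [|[|[|[|//]]]] _ _ _ //= _.
all: by try case: eqVneq; lia.
Qed.

Lemma Tn_dist_lipschitz n (v x y : Tn_vertex n) : 5 < n -> Tn x y ->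
  Tn_dist v x <= (Tn_dist v y).+1 /\ Tn_dist v y <= (Tn_dist v x).+1.
Proof. by move=> n6 /orP[] /(Tn_dist_arc v n6) []. Qed.

(** If no neighbor were closer, the inequalities at all neighbors of [x], listed by its row, would
    contradict the closed form. *)
Lemma Tn_dist_descent n (v x : Tn_vertex n) : 5 < n -> 0 < Tn_dist v x ->
  exists2 y, Tn x y & Tn_dist v y < Tn_dist v x.
Proof.
move=> n6; case: (pickP (fun y => Tn x y && (Tn_dist v y < Tn_dist v x))).
  by move=> y /andP[]; exists y.
case: v x => [[s s4] m] [[r r4] l] min_x x0; exfalso.
have := offset_lt (ltn_ord m) (ltn_ord l).
have /= := offset_ordS l (ltn_ord m); have /= := offset_ord_pred l (ltn_ord m).
move=> oP oS ltkn.
have step t (t4 : t < 4) i : Tn (Ordinal r4, l) (Ordinal t4, i) ->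
    cyl_dist n s r (offset n m l) <= cyl_dist n s t (offset n m i).
  by move=> xy; have /negbT := min_x (Ordinal t4, i); rewrite negb_and xy -leqNgt.
move: x0; rewrite /Tn_dist /=.
case: r r4 step {min_x} => [|[|[|[|//]]]] r4 step.
- move: (step 0 isT (ordS l)) (step 0 isT (ord_pred l))
    (step 1 isT l) (step 1 isT (ord_pred l)).
  rewrite /Tn /= ?ord_predK !eqxx ?orbT oS oP => {oS oP step}.
  move=> /(_ isT) + /(_ isT) + /(_ isT) + /(_ isT).
  move: (offset n m l) ltkn => k ltkn; rewrite /cyl_dist /strip_dist.
  by move: s s4 => [|[|[|[|//]]]] _ /=; case: (eqVneq k.+1 n); case: (eqVneq k 0); lia.
- move: (step 1 isT (ordS l)) (step 1 isT (ord_pred l)) (step 0 isT l)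
    (step 0 isT (ordS l)) (step 2 isT l) (step 2 isT (ord_pred l)).
  rewrite /Tn /= ?ord_predK !eqxx ?orbT oS oP => {oS oP step}.
  (* R, L and H stand for the next, the previous and the same column; the digit
     is the row of the neighbor. *)
  move=> /(_ isT) R1 /(_ isT) L1 /(_ isT) H0 /(_ isT) R0 /(_ isT) H2 /(_ isT) L2.
  move: (offset n m l) ltkn R1 L1 H0 R0 H2 L2 => k ltkn.
  rewrite /cyl_dist /strip_dist.
  move: s s4 => [|[|[|[|//]]]] _ /= R1 L1 H0 R0 H2 L2.
  (* For [v] in row 0, a step to row 0 gets closer; for row 1, a step along row 1. For rows 2 and 3,
     a step along row 1 does so when [k >= 2]; otherwise a step to row 2 or to the next column
     does. *)
  1: by clear R1 L1 H2 L2; move: R0; case: (eqVneq k.+1 n); lia.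
  1: by clear H0 R0 H2 L2; move: R1 L1; case: (eqVneq k.+1 n); case: (eqVneq k 0); lia.
  1,2: clear H0 R0; have [k2|k2] := ltnP k 2.
  2,4: by clear H2 L2; move: R1 L1; case: (eqVneq k.+1 n); case: (eqVneq k 0); lia.
  1,2: clear L1; move: R1 L2.
  1,2: by rewrite (_ : k.+1 == n = false); [case: (eqVneq k 0); lia | lia].
- move: (step 1 isT (ordS l)) (step 1 isT l) (step 3 isT l).
  rewrite /Tn /= ?ord_predK !eqxx ?orbT oS => {oS oP step}.
  move=> /(_ isT) + /(_ isT) + /(_ isT).
  move: (offset n m l) ltkn => k ltkn; rewrite /cyl_dist /strip_dist.
  by move: s s4 => [|[|[|[|//]]]] _ /=; case: eqVneq; lia.
- move: (step 3 isT (ordS l)) (step 3 isT (ord_pred l)) (step 2 isT l).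
  rewrite /Tn /= ?ord_predK !eqxx ?orbT oS oP => {oS oP step}.
  move=> /(_ isT) + /(_ isT) + /(_ isT).
  move: (offset n m l) ltkn => k ltkn; rewrite /cyl_dist /strip_dist.
  by move: s s4 => [|[|[|[|//]]]] _ /=; case: (eqVneq k.+1 n); case: (eqVneq k 0); lia.
Qed.

Lemma dist_Tn n (x v : Tn_vertex n) : 5 < n -> dist (@Tn n) x v = Tn_dist v x.
Proof.
move=> n6; move: x; apply: dist_potential => [[r l]|x y|x]; last exact: Tn_dist_descent.
  case: v => s m; rewrite /Tn_dist cyl_dist_eq0 ?offset_lt ?offset_eq0 //=.
by case/(Tn_dist_lipschitz v n6).
Qed.

(** * Lower bound: two landmarks never suffice *)

(* Each pair is the row of a vertex and its offset from a center in row [r]. *)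
Definition sphere2 (n : nat) (r : nat) : seq (nat * nat) :=
  match r with
  | 0 => [:: (0, 2); (0, n - 2); (1, 1); (1, n - 2); (2, 0); (2, n - 1)]
  | 1 => [:: (1, 2); (1, n - 2); (0, n - 1); (0, 2); (2, 1); (2, n - 2)]
  | 2 => [:: (0, 0); (0, 1); (0, 2); (1, n - 1); (1, 2); (2, 1)]
  | _ => [:: (3, 2); (3, n - 2); (2, 1); (2, n - 1); (1, 0); (1, 1)]
  end.

Lemma Tn_collision n (u w : Tn_vertex n) : 5 < n ->
  exists x y, [/\ x != y, dist (@Tn n) x u = dist (@Tn n) y u
                 & dist (@Tn n) x w = dist (@Tn n) y w].
Proof.
move=> n6; have n0 : 0 < n by lia.
case: u => [[r r4] m].
(* [nat_of] inverts [vtx], so distinctness and distances are checked on pairs of numbers. *)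
pose vtx (q : nat * nat) : Tn_vertex n := (inord q.1, Ordinal (ltn_pmod (m + q.2) n0)).
pose nat_of (x : Tn_vertex n) := (val x.1, offset n m x.2).
have vtxK q : q.1 < 4 -> q.2 < n -> nat_of (vtx q) = q.
  case: q => a k /= a4 ltkn; rewrite /nat_of /= inordK //; congr (_, _).
  have ltmn := ltn_ord m; rewrite /offset.
  have [lt|le] := ltnP (m + k) n; first by rewrite modn_small // leq_addr addKn.
  rewrite -(subnK le) modnDr modn_small; last by lia.
  by case: (leqP m _); lia.
have S_in q : q \in sphere2 n r -> q.1 < 4 /\ q.2 < n.
  by case: r {r4} => [|[|[|r]]]; rewrite /= !inE => /or4P[|||/or3P[]] /eqP-> /=; lia.
apply: (@sphere_collision _ _ _ _ 2 [seq vtx q | q <- sphere2 n r]).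
- by move=> x y; rewrite !dist_Tn //; apply: Tn_dist_lipschitz.
- by rewrite card_prod !card_ord; lia.
- apply: (@map_uniq _ _ nat_of); rewrite -map_comp.
  rewrite (_ : [seq _ | q <- _] = sphere2 n r).
    by case: r {r4 S_in} => [|[|[|r]]]; rewrite /= !inE !xpair_eqE /=; lia.
  by rewrite -[RHS]map_id; apply/eq_in_map => q /S_in[] /=; exact: vtxK.
- move=> _ /mapP[q qS ->]; have [q1 q2] := S_in q qS.
  rewrite dist_Tn //.
  rewrite -[Tn_dist _ _]/(cyl_dist n r (nat_of (vtx q)).1 (nat_of (vtx q)).2) vtxK //.
  move: q {q1 q2} qS; rewrite /cyl_dist /strip_dist.
  case: r r4 {S_in} => [|[|[|[|//]]]] _ [a k]; rewrite /= !inE;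
    by move=> /or4P[|||/or3P[]] /eqP[-> ->] /=; lia.
- by rewrite size_map; case: r {r4 S_in} => [|[|[|]]].
Qed.

(** * Upper bound: the codes for four landmarks *)

(* The distances from the vertex in row [r] (first index) and column [l] to the
   landmarks (0, 0), (0, 1), (0, h) and (3, 0), with h = n / 2 rounded down. *)
Variant codes_spec (n h l : nat) : nat -> nat -> nat -> nat -> nat -> Prop :=
| Codes00 of l = 0 : codes_spec n h l 0 0 1 h 3
| Codes01 of l = 1 : codes_spec n h l 0 1 0 h.-1 3
| Codes02 of 1 < l <= h : codes_spec n h l 0 l l.-1 (h - l) l.+1
| Codes03 of l = h.+1 : codes_spec n h l 0 (n - h.+1) h 1 h.+2
| Codes04 of h.+1 < l < n :
    codes_spec n h l 0 (n - l) (n - l).+1 (l - h) (n - l).+3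
| Codes10 of l = 0 : codes_spec n h l 1 1 1 h 2
| Codes11 of 0 < l < h : codes_spec n h l 1 l.+1 l (h - l) l.+1
| Codes12 of l = h : codes_spec n h l 1 (n - h) h 1 h.+1
| Codes13 of h < l < n :
    codes_spec n h l 1 (n - l) (n - l).+1 (l - h).+1 (n - l).+2
| Codes20 of l = 0 : codes_spec n h l 2 2 2 h 1
| Codes21 of 0 < l < h.-1 : codes_spec n h l 2 l.+2 l.+1 (h - l) l.+1
| Codes22 of l = h.-1 : codes_spec n h l 2 h.+1 h 2 h
| Codes23 of l = h : codes_spec n h l 2 (n - h) h.+1 2 h.+1
| Codes24 of h < l < n.-1 :
    codes_spec n h l 2 (n - l) (n - l).+1 (l - h).+2 (n - l).+1
| Codes25 of l = n.-1 : codes_spec n h l 2 2 2 h.+1 2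
| Codes30 of l = 0 : codes_spec n h l 3 3 3 h.+1 0
| Codes31 of 0 < l < h.-1 : codes_spec n h l 3 l.+3 l.+2 (h - l).+1 l
| Codes32 of l = h.-1 : codes_spec n h l 3 h.+2 h.+1 3 h.-1
| Codes33 of l = h : codes_spec n h l 3 (n - h).+1 h.+2 3 h
| Codes34 of h < l < n.-1 :
    codes_spec n h l 3 (n - l).+1 (n - l).+2 (l - h).+3 (n - l)
| Codes35 of l = n.-1 : codes_spec n h l 3 3 3 h.+2 1.

Lemma codesP n r l : 5 < n -> r < 4 -> l < n ->
  codes_spec n n./2 l r
    (cyl_dist n 0 r (offset n 0 l)) (cyl_dist n 0 r (offset n 1 l))
    (cyl_dist n 0 r (offset n n./2 l)) (cyl_dist n 3 r (offset n 0 l)).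
Proof.
move=> n6 r4 ln.
(* These bounds on [h] treat both parities of [n] at once. *)
have [h [hn nh ->]] : exists h, [/\ h.*2 <= n, n <= h.*2.+1 & n./2 = h].
  by exists n./2; split=> //; have := odd_double_half n; case: odd; lia.
(* The constructor can now be chosen by row and range of [l] alone, with the values left as
   equations. *)
have spec_eq a b c d a' b' c' d' :
    codes_spec n h l r a b c d -> [/\ a' = a, b' = b, c' = c & d' = d] ->
  codes_spec n h l r a' b' c' d' by move=> ? [-> -> -> ->].
rewrite /cyl_dist /strip_dist /offset.
have [l0|l0] := posnP l; have [hl|hl] := leqP h l; try (exfalso; lia).
all: have [l1|l1] := eqVneq l 1; try (exfalso; lia).
all: have [l2|l2] := eqVneq l h.-1; try (exfalso; lia).
all: have [l3|l3] := eqVneq l h; try (exfalso; lia).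
all: have [l4|l4] := eqVneq l h.+1; try (exfalso; lia).
all: have [l5|l5] := eqVneq l n.-1; try (exfalso; lia).
all: case: r r4 spec_eq => [|[|[|[|//]]]] _ spec_eq /=; rewrite ?leq0n ?addn0 ?subn0.
all: by apply: spec_eq; [econstructor; lia | split; lia].
Qed.

(** Each disjunct omits one landmark. Every pair of the 21 cases gives a linear problem in [n], [h],
    [l] and [m]. *)
Lemma codes_inj n r s l m a b c d a' b' c' d' : 5 < n ->
  codes_spec n n./2 l r a b c d -> codes_spec n n./2 m s a' b' c' d' ->
  [\/ [/\ a = a', b = b' & c = c'], [/\ a = a', b = b' & d = d'],
      [/\ a = a', c = c' & d = d'] | [/\ b = b', c = c' & d = d']] ->
  r = s /\ l = m.
Proof.
move=> n6.
have [h [hn nh ->]] : exists h, [/\ h.*2 <= n, n <= h.*2.+1 & n./2 = h].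
  by exists n./2; split=> //; have := odd_double_half n; case: odd; lia.
by case=> {r a b c d} ?; case=> {s a' b' c' d'} ?; case=> [] []; lia.
Qed.

Theorem theorem0p5 (n : nat) (hn : 6 <= n) : fdim (@Tn n) = 4.
Proof.
have [n0 n1 nh] : [/\ 0 < n, 1 < n & n./2 < n] by split; lia.
apply/fdimP; split; last first.
  move=> R; apply: fault_tolerant_card => S; apply: (resolving_card (ord0, Ordinal n0)).
  by move=> u w; apply: Tn_collision.
pose a : Tn_vertex n := (ord0, Ordinal n0); pose b : Tn_vertex n := (ord0, Ordinal n1).
pose c : Tn_vertex n := (ord0, Ordinal nh); pose d : Tn_vertex n := (ord_max, Ordinal n0).
exists [set x in [:: a; b; c; d]]; last first.
  rewrite cardsE; apply/card_uniqP.
  by rewrite /= !inE !xpair_eqE -!val_eqE /=; lia.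
have codes_eq (x y : Tn_vertex n) :
    let same w := dist (@Tn n) x w = dist (@Tn n) y w in
    [\/ [/\ same a, same b & same c], [/\ same a, same b & same d],
       [/\ same a, same c & same d] | [/\ same b, same c & same d]] -> x = y.
  case: x y => [r l] [s m] /=; rewrite !dist_Tn //.
  have codes (t : 'I_4) (i : 'I_n) := codesP hn (ltn_ord t) (ltn_ord i).
  by case/(codes_inj hn (codes r l) (codes s m)) => /val_inj-> /val_inj->.
apply/andP; split.
  apply/resolvingP => x y xyR; apply: codes_eq; constructor 1.
  by split; apply: xyR; rewrite !inE eqxx ?orbT.
apply/forall_inP => u; rewrite inE => uR; apply/resolvingP => x y xyR; apply: codes_eq.
have {}xyR w : w \in [:: a; b; c; d] -> w != u -> dist (@Tn n) x w = dist (@Tn n) y w.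
  by move=> wR wu; apply: xyR; rewrite in_setD1 wu inE.
move: uR; rewrite !inE => /or4P[] /eqP def_u.
(* The triple to use is the one that omits the deleted landmark [u]. *)
1: constructor 4.
2: constructor 3.
3: constructor 2.
4: constructor 1.
all: split; apply: xyR; rewrite ?inE ?eqxx ?orbT //.
all: by rewrite def_u !xpair_eqE -!val_eqE /=; lia.
Qed.
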